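(* Let $t\ge 0$ be an integer and let $\epsilon\in\mathbb{R}$ satisfy $0<\epsilon\ll 1$. There exists a digraph $G$ with nonnegative edge costs and two distinct distinguished vertices $p,q$, on $\nu=\nu(t,\epsilon)=\Theta(t/\epsilon)$ vertices, such that, for the metric completion $H$ of $G$, the integrality ratio of the level-$t$ Sherali–Adams tightening of the standard LP relaxation of $p$-$q$ path ATSP on $H$ is at least $1+\frac{2-\epsilon}{3t+4}$.
   Context: Metric completion: for a digraph $G=(V,E)$ with nonnegative edge costs $c$, its metric completion is the complete digraph $H$ on $V$ in which the cost $c'(v,w)$ of edge $(v,w)$ is the minimum $c$-cost of a $v$–$w$ dipath in $G$. Standard LP of $p$-$q$ path ATSP on a digraph $H=(V,E_H)$ with costs $c'$: variables $x_e$, $e\in E_H$; minimize $\sum_e c'_e x_e$ subject to $x(\delta^{in}(S))\ge1$ for all $\emptyset\subsetneq S\subseteq V-\{p\}$; $x(\delta^{out}(S))\ge1$ for all $\emptyset\subsetneq S\subseteq V-\{q\}$; $x(\delta^{in}(\{v\}))=1$ for all $v\in V-\{p\}$; $x(\delta^{out}(\{v\}))=1$ for all $v\in V-\{q\}$; $x(\delta^{in}(\{p\}))=0$; $x(\delta^{out}(\{q\}))=0$; $0\le x\le1$. Here $\delta^{out}(U)$ ($\delta^{in}(U)$) is the set of edges leaving (entering) $U$ and $x(F)=\sum_{e\in F}x_e$. Let $\hat P$ denote its feasible polytope. Sherali–Adams: let $\hat P\subseteq[0,1]^n$ be a polytope given by a finite system of linear inequalities $\sum_{i=1}^n a_i y_i\ge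 b$ (the system includes $0\le y_i\le 1$ for all $i$; equations are written as two inequalities). For an integer $t\ge0$, the level-$t$ Sherali–Adams tightening $SA^t(\hat P)$ is the set of vectors $y=(y_S)$ indexed by subsets $S\subseteq\{1,\dots,n\}$ with $|S|\le t+1$, with $y_\emptyset=1$, such that for every inequality $\sum_i a_i y_i\ge b$ of the system and every pair of disjoint sets $S,Q\subseteq\{1,\dots,n\}$ with $|S|+|Q|\le t$: $\sum_{i=1}^n a_i\sum_{T\subseteq Q}(-1)^{|T|}y_{S\cup T\cup\{i\}}\ \ge\ b\sum_{T\subseteq Q}(-1)^{|T|}y_{S\cup T}$. Integrality ratio of the instance: the minimum cost of a Hamiltonian dipath from $p$ to $q$ in $H$ (w.r.t. $c'$) divided by $\min\{\sum_{e}c'_e\,y_{\{e\}} : y\in SA^t(\hat P)\}$. *)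

(* Defs.v *)
From mathcomp Require Import all_boot all_order all_algebra.
From mathcomp Require Import classical_sets reals.

Set Implicit Arguments.
Unset Strict Implicit.
Unset Printing Implicit Defensive.

Import Order.TTheory GRing.Theory Num.Theory.
Local Open Scope ring_scope.

Definition is_min (R : realType) (A : set R) (m : R) : Prop :=
  A m /\ lbound A m.

(* A digraph on V is a relation E : rel V; edge costs are given by a function
   c : V -> V -> R, whose values outside E are never used. *)

Definition nonneg_costs (R : realType) (V : finType) (E : rel V)
    (c : V -> V -> R) : Prop :=
  forall v w, E v w -> 0 <= c v w.

(* The vertex sequence of the dipath is v :: s. *)
Definition dipath (V : finType) (E : rel V) (v w : V) (s : seq V) : bool :=
  [&& path E v s, uniq (v :: s) & last v s == w].

Definition hamiltonian_dipath (V : finType) (E : rel V) (v w : V)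
    (s : seq V) : bool :=
  dipath E v w s && [forall u, u \in v :: s].

Definition dipath_cost (R : realType) (V : finType) (c : V -> V -> R)
    (v : V) (s : seq V) : R :=
  \sum_(x <- pairmap c v s) x.

Definition complete (V : finType) : rel V := fun v w => v != w.

(* As all the minima are required to exist, this forces (V, E) to be strongly
   connected. *)
Definition is_metric_completion (R : realType) (V : finType) (E : rel V)
    (c c' : V -> V -> R) : Prop :=
  forall v w, complete v w ->
    is_min [set x | exists2 s, dipath E v w s & x = dipath_cost c v s]%classic
           (c' v w).

(* A pair (a, b) stands for the inequality \sum_i a i * y i >= b. *)
Definition lin_eq (R : realType) (I : finType) (a : {ffun I -> R}) (b : R) :
    seq ({ffun I -> R} * R) :=
  [:: (a, b); (- a, - b)].

(* The linear form y |-> y(D) = \sum_(i in D) y i. *)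
Definition sum_form (R : realType) (I : finType) (D : {set I}) :
    {ffun I -> R} :=
  [ffun i => (i \in D)%:R].

Definition box (R : realType) (I : finType) : seq ({ffun I -> R} * R) :=
  [seq (sum_form R [set i], 0) | i <- enum I] ++
  [seq (- sum_form R [set i], - 1) | i <- enum I].

(* The coordinates of y at sets of more than t + 1 elements are junk: they
   occur neither in these constraints nor in the objective function. *)
Definition sherali_adams (R : realType) (I : finType) (t : nat)
    (sys : seq ({ffun I -> R} * R)) (y : {set I} -> R) : Prop :=
  y finset.set0 = 1 /\
  forall (a : {ffun I -> R}) (b : R), (a, b) \in sys ->
  forall S Q : {set I}, [disjoint S & Q] -> (#|S| + #|Q| <= t)%N ->
    \sum_i a i * (\sum_(T : {set I} | T \subset Q)
                    (-1) ^+ #|T| * y (S :|: T :|: [set i]))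
    >= b * (\sum_(T : {set I} | T \subset Q) (-1) ^+ #|T| * y (S :|: T)).

Definition delta_out (V : finType) (E : rel V) (U : {set V}) :
    {set {e : V * V | E e.1 e.2}} :=
  [set e | ((val e).1 \in U) && ((val e).2 \notin U)].

Definition delta_in (V : finType) (E : rel V) (U : {set V}) :
    {set {e : V * V | E e.1 e.2}} :=
  [set e | ((val e).1 \notin U) && ((val e).2 \in U)].

Definition path_atsp_lp (R : realType) (V : finType) (E : rel V) (p q : V) :
    seq ({ffun {e : V * V | E e.1 e.2} -> R} * R) :=
  [seq (sum_form R (delta_in E U), 1)
     | U <- enum {set V} & (U != finset.set0) && (U \subset [set~ p])] ++
  [seq (sum_form R (delta_out E U), 1)
     | U <- enum {set V} & (U != finset.set0) && (U \subset [set~ q])] ++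
  flatten [seq lin_eq (sum_form R (delta_in E [set v])) 1
     | v <- enum V & v != p] ++
  flatten [seq lin_eq (sum_form R (delta_out E [set v])) 1
     | v <- enum V & v != q] ++
  lin_eq (sum_form R (delta_in E [set p])) 0 ++
  lin_eq (sum_form R (delta_out E [set q])) 0 ++
  box R {e : V * V | E e.1 e.2}.

Definition sa_cost (R : realType) (V : finType) (E : rel V)
    (c : V -> V -> R) (y : {set {e : V * V | E e.1 e.2}} -> R) : R :=
  \sum_(e : {e : V * V | E e.1 e.2}) c (val e).1 (val e).2 * y [set e].

(* r is the integrality ratio, on the complete digraph on V with costs c', of
   the level-t tightening.  If lp = 0 the ratio is not defined. *)
Definition is_integrality_ratio (R : realType) (V : finType)
    (c' : V -> V -> R) (p q : V) (t : nat) (r : R) : Prop :=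
  exists opt lp : R,
    [/\ is_min [set x | exists2 s, hamiltonian_dipath (@complete V) p q s
                                 & x = dipath_cost c' p s]%classic opt,
        is_min [set x | exists2 y,
                    sherali_adams t (path_atsp_lp R (@complete V) p q) y
                  & x = sa_cost c' y]%classic lp,
        0 < lp
      & r = opt / lp].

(* Main.v *)
(* Write N for a number of order t / eps.  The vertices f_0, ..., f_N and
   b_0, ..., b_N lie over the positions 0, ..., N of a line, with p = f_0 and
   q = f_N, and the cost of (v, w) is the distance of the positions, except that
   u = b_N can only be entered from position 0, so that entering it from
   position i costs N + i.  A Hamiltonian dipath from p to q has to come back to
   position 0 before it enters u and ends at the far side after it, so that it
   crosses all but one of the N unit segments three times: its cost is at
   least 3N - 2.

   Let X_N be the union of the dipath f_0, ..., f_N and the dicycle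
   b_N, ..., b_0, b_N, of cost 3N.  Deleting the two arcs of X_N over the segment
   [j, j+1] and adding the arcs f_j b_j and b_{j+1} f_{j+1} of cost 0 turns it
   into a Hamiltonian dipath X_j of cost 3N - 2.  Put weight 1/(t+2) on each X_j
   with j < N, and the remaining (negative) weight 1 - N/(t+2) on X_N.  This is
   not a probability measure, but the level-t inequalities condition on at most
   t arcs, each of which depends on at most one j, so that at least N - t of the
   sets X_j are indistinguishable from X_N and outweigh its negative weight.
   The objective value is 3N - 2N/(t+2) = N(3t+4)/(t+2). *)
Require Import Defs.
From mathcomp Require Import all_boot all_order all_algebra.
From mathcomp Require Import classical_sets reals.
From mathcomp Require boolp topology normedtype derive.
From mathcomp Require Import zify ring lra.
Import Order.TTheory GRing.Theory Num.Theory.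
Local Open Scope ring_scope.

Set Implicit Arguments.
Unset Strict Implicit.
Unset Printing Implicit Defensive.

(** * Signed measures in the Sherali-Adams hierarchy *)

(** Inclusion-exclusion: the left side expands the product over [i \in Q] of [1 - (i \in X)%:R].
    Setting [F] to 0 outside [Q] lets the product range over all of [I]. *)
Lemma sum_signed_subsets (R : comNzRingType) (I : finType) (Q X : {set I}) :
  \sum_(T : {set I} | T \subset Q) (-1) ^+ #|T| * (T \subset X)%:R
  = [disjoint Q & X]%:R :> R.
Proof.
pose F i : R := if i \in Q then - (i \in X)%:R else 0.
transitivity (\prod_i (F i + 1)); last first.
  case: (boolP [disjoint Q & X]) => [dQX|/pred0Pn[i /= /andP[iQ iX]]].
    apply: big1 => i _; rewrite /F; case: ifP => [iQ|_]; last by rewrite add0r.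
    by rewrite (disjointFr dQX iQ) oppr0 add0r.
  by rewrite (bigD1 i) //= /F iQ iX addNr mul0r.
rewrite bigA_distr [LHS]big_mkcond; apply: eq_bigr => T _.
rewrite -big_mkcond /=.
case: (boolP (T \subset Q)) => [TQ|/fintype.subsetPn[i iT iQ]]; last first.
  by rewrite (bigD1 i) //= /F (negbTE iQ) mul0r.
transitivity (\prod_(i in T) (- (i \in X)%:R : R)); last first.
  by apply: eq_bigr => i iT; rewrite /F (fintype.subsetP TQ).
rewrite prodrN; congr (_ * _).
case: (boolP (T \subset X)) => [TX|/fintype.subsetPn[i iT iX]].
  by rewrite big1 // => i iT; rewrite (fintype.subsetP TX).
by rewrite (bigD1 i) //= (negbTE iX) mul0r.
Qed.

(* [mu] may take negative values. *)
Definition moments (R : pzRingType) (I : finType) (n : nat) (mu : nat -> R)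
    (X : nat -> {set I}) (S : {set I}) : R :=
  \sum_(j < n) mu j * (S \subset X j)%:R.

(** The alternating sum conditions the signed measure on containing [S] and avoiding [Q]. *)
Lemma moments_setU_signed (R : comNzRingType) (I : finType) (n : nat)
    (mu : nat -> R) (X : nat -> {set I}) (S Q : {set I}) :
  \sum_(T : {set I} | T \subset Q) (-1) ^+ #|T| * moments n mu X (S :|: T)
  = \sum_(j < n) mu j * ((S \subset X j) && [disjoint Q & X j])%:R.
Proof.
under eq_bigr do rewrite mulr_sumr.
rewrite exchange_big; apply: eq_bigr => j _ /=.
rewrite -mulnb natrM -sum_signed_subsets mulr_sumr mulr_sumr.
apply: eq_bigr => T _; rewrite finset.subUset -mulnb natrM; ring.
Qed.

(** By linearity, a Sherali-Adams inequality compares 0 with the weighted sum of the slacks of those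
    [X j] that meet the conditioning. *)
Lemma moments_conditioned (R : comNzRingType) (I : finType) (n : nat)
    (mu : nat -> R) (X : nat -> {set I}) (S Q : {set I}) (a : I -> R) (b : R) :
  \sum_i a i * (\sum_(T : {set I} | T \subset Q)
                  (-1) ^+ #|T| * moments n mu X (S :|: T :|: [set i]))
  - b * (\sum_(T : {set I} | T \subset Q)
           (-1) ^+ #|T| * moments n mu X (S :|: T))
  = \sum_(j < n) mu j * ((S \subset X j) && [disjoint Q & X j])%:R
                 * (\sum_(i in X j) a i - b).
Proof.
under [\sum_i _]eq_bigr => i _.
  under eq_bigr do rewrite finset.setUAC.
  rewrite moments_setU_signed mulr_sumr; over.
rewrite moments_setU_signed exchange_big mulr_sumr -sumrB.
apply: eq_bigr => j _ /=; rewrite mulrBr mulr_sumr [in RHS]big_mkcond /=.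
congr (_ - _); last by rewrite mulrC.
apply: eq_bigr => i _; rewrite finset.subUset finset.sub1set.
by case: ifP => _; rewrite ?andbF ?andbT /= ?andFb ?mulr0 ?mulrA //; ring.
Qed.

(* The last set has negative weight if n > t + 2; [deletable] makes up for it. *)
Definition deletion_weight (R : realType) (t n j : nat) : R :=
  if j == n then 1 - n%:R / t.+2%:R else t.+2%:R^-1.

(* Conditioning on at most t elements leaves X n together with all but t of the
   sets X j, whose weights add up to at least 2 / (t + 2); the second clause
   says that this pays for the loss of slack in passing from X n to the X j. *)
Definition deletable (R : realType) (I : finType) (n : nat)
    (X : nat -> {set I}) (a : I -> R) (b : R) : Prop :=
  (forall j, (j < n)%N -> b <= \sum_(i in X j) a i) /\
  (\sum_(i in X n) a i <= b \/
   forall C : {set 'I_n},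
     \sum_(j in C) (\sum_(i in X n) a i - \sum_(i in X j) a i)
     <= 2 * (\sum_(i in X n) a i - b)).

(** [own e] is the only index below [n] at which membership of [e] may differ from that in [X n].
    Hence, when [X n] meets a conditioning on at most [t] elements, at most [t] of the other sets
    violate it. *)
Lemma moments_sherali_adams (R : realType) (I : finType) (t n : nat)
    (sys : seq ({ffun I -> R} * R)) (X : nat -> {set I}) (own : I -> nat) :
  (t.+2 <= n)%N ->
  (forall e j, (j < n)%N -> own e != j -> (e \in X j) = (e \in X n)) ->
  (forall a b, (a, b) \in sys -> deletable n X a b) ->
  sherali_adams t sys (moments n.+1 (deletion_weight R t n) X).
Proof.
move=> tn ownP sysP; set y := moments _ _ _.
have t2gt0 : 0 < t.+2%:R :> R by rewrite ltr0n.
have w1 j : (j < n)%N -> deletion_weight R t n j = t.+2%:R^-1.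
  by move=> jn; rewrite /deletion_weight ltn_eqF.
have wn : deletion_weight R t n n = 1 - n%:R / t.+2%:R.
  by rewrite /deletion_weight eqxx.
split=> [|a b abs S Q dSQ cSQ].
  rewrite /y /moments big_ord_recr /= finset.sub0set mulr1 wn.
  under eq_bigr => j _ do rewrite finset.sub0set mulr1 w1 //.
  by rewrite sumr_const card_ord mulr_natl addrC subrK.
rewrite -subr_ge0 moments_conditioned big_ord_recr /= wn.
have [Xj Xn] := sysP _ _ abs.
set z := fun j => (S \subset X j) && [disjoint Q & X j].
pose phi j := \sum_(i in X j) a i - b.
have phi_ge0 j : (j < n)%N -> 0 <= phi j by move=> /Xj; rewrite subr_ge0.
have -> : \sum_(i < n) deletion_weight R t n i * (z i)%:R * phi i
          = t.+2%:R^-1 * \sum_(i < n | z i) phi i.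
  rewrite mulr_sumr [RHS]big_mkcond; apply: eq_bigr => i _.
  by rewrite w1 //; case: (z i); rewrite ?mulr1 ?mulr0 ?mul0r.
rewrite -/(z n) -/(phi n).
have sum_ge0 : 0 <= \sum_(i < n | z i) phi i.
  by apply: sumr_ge0 => i _; exact: phi_ge0.
(* If [X n] violates the conditioning, the only weight that can be negative drops out. *)
have [zn|_] := boolP (z n); last first.
  by rewrite mulr0 mul0r addr0 mulr_ge0 // invr_ge0 ltW.
rewrite mulr1.
case: Xn => [Xn|Xn].
  apply: addr_ge0; first by rewrite mulr_ge0 // invr_ge0 ltW.
  apply: mulr_le0; last by rewrite subr_le0.
  by rewrite subr_le0 ler_pdivlMr // mul1r ler_nat.
(* An index that violates the conditioning while [X n] meets it must own an element of [S :|: Q]. *)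
have cardz : (#|[set j : 'I_n | ~~ z j]| <= t)%N.
  have cU : (#|S :|: Q| <= #|S| + #|Q|)%N by rewrite cardsU leq_subr.
  apply: leq_trans cSQ; apply: leq_trans cU.
  rewrite !cardE -(size_map val) -(size_map own (enum (S :|: Q))).
  apply: uniq_leq_size.
    by rewrite map_inj_uniq ?enum_uniq //; exact: val_inj.
  move=> _ /mapP[j + ->]; rewrite mem_enum inE => zj.
  apply/mapP; case: (boolP [exists e in S :|: Q, own e == j]).
    by move=> /exists_inP[e eSQ /eqP ej]; exists e => //; rewrite mem_enum.
  rewrite negb_exists_in => /forall_inP noown; case/negP: zj.
  have eqX e : e \in S :|: Q -> (e \in X j) = (e \in X n).
    by move=> eSQ; apply: ownP => //; exact: noown.
  case/andP: zn => /fintype.subsetP SX dQX; apply/andP; split.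
    apply/fintype.subsetP => e eS; rewrite eqX ?SX //.
    by rewrite inE eS.
  apply/pred0P => e /=; apply/negbTE/negP => /andP[eQ].
  by rewrite eqX ?(disjointFr dQX eQ) // inE eQ orbT.
have cardz2 : (#|[set j : 'I_n | z j]| + #|[set j : 'I_n | ~~ z j]| = n)%N.
  rewrite -[RHS]card_ord -(cardsC [set j : 'I_n | z j]); congr (_ + _)%N.
  by apply: eq_card => j; rewrite !inE.
have loss := Xn [set j : 'I_n | z j].
have phin : 0 <= phi n.
  by have := Xn finset.set0; rewrite big_set0 -/(phi n); lra.
have sum_ge : phi n * #|[set j : 'I_n | z j]|%:R - 2 * phi n
              <= \sum_(i < n | z i) phi i.
  have : \sum_(j in [set j : 'I_n | z j]) (phi n - phi j) <= 2 * phi n.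
    apply: le_trans loss; apply: ler_sum => j _; rewrite /phi; lra.
  rewrite sumrB sumr_const -mulr_natr.
  rewrite (eq_bigl (fun j : 'I_n => z j)); first lra.
  by move=> j; rewrite inE.
have nE : n%:R = #|[set j : 'I_n | z j]|%:R + #|[set j : 'I_n | ~~ z j]|%:R :> R.
  by rewrite -natrD cardz2.
have mt : #|[set j : 'I_n | ~~ z j]|%:R <= t%:R :> R by rewrite ler_nat.
have t2 : t.+2%:R = t%:R + 2 :> R by rewrite -addn2 natrD.
(* Let A and B count the indices that meet and violate the conditioning, so that A + B = n.
   Multiplied by t + 2, the total is at least (A - 2 + t + 2 - n) [phi n] = (t - B) [phi n], which
   is nonnegative. *)
have -> : t.+2%:R^-1 * (\sum_(i < n | z i) phi i)
            + (1 - n%:R / t.+2%:R) * phi n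
          = (\sum_(i < n | z i) phi i + (t.+2%:R - n%:R) * phi n) / t.+2%:R.
  by rewrite [in RHS]mulrDl [in RHS]mulrAC [in RHS]mulrBl divff ?gt_eqF // mulrC.
apply: divr_ge0; last exact: ltW.
rewrite nE t2.
move: sum_ge mt phin; set A := #|_|%:R; set B := #|_|%:R => h1 h2 h3.
have : 0 <= (t%:R - B) * phi n by rewrite mulr_ge0 // subr_ge0.
lra.
Qed.

(** * Inequalities that tolerate deletion *)

Lemma opp_ffunE (I : finType) (V : zmodType) (f : {ffun I -> V}) i :
  (- f) i = - f i.
Proof. exact: ffunE. Qed.

Lemma sum_nat_eq_le1 (R : numDomainType) (n k : nat) (C : {set 'I_n}) :
  \sum_(j in C) (k == j)%:R <= 1 :> R.
Proof.
rewrite -natr_sum lern1.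
have -> : (\sum_(j in C) (k == j))%N = #|[set j in C | k == j]|.
  rewrite -sum1dep_card big_mkcondr; apply: eq_bigr => j _.
  by case: eqP.
apply/card_le1_eqP => i j; rewrite !inE => /andP[_ /eqP ki] /andP[_ /eqP kj].
by apply: val_inj; rewrite /= -ki -kj.
Qed.

Section DeletionFamily.
Variables (R : realType) (I : finType) (n : nat).
Variables (X : nat -> {set I}) (own : I -> nat).
Hypothesis ownP :
  forall e j, (j < n)%N -> own e != j -> (e \in X j) = (e \in X n).

(** An element [i] of [X n] can be missing only from the set of index [own i], so its weight is lost
    at most once; elements gained only lower the left side. *)
Lemma deletion_loss (f : I -> R) (C : {set 'I_n}) : (forall i, 0 <= f i) ->
  \sum_(j in C) (\sum_(i in X n) f i - \sum_(i in X j) f i)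
  <= \sum_(i in X n) f i.
Proof.
move=> f0.
apply: (@le_trans _ _ (\sum_(j in C) \sum_(i in X n) f i * (own i == j)%:R)).
  apply: ler_sum => j _; rewrite [X in X - _]big_mkcond [X in _ - X]big_mkcond.
  rewrite [leRHS]big_mkcond -sumrB /=; apply: ler_sum => i _.
  have [_|/ownP ->] := eqVneq (own i) j; last exact: ltn_ord.
    by have := f0 i; rewrite mulr1; do 2!case: ifP => _; lra.
  by case: ifP => _; rewrite ?mulr0 subrr.
rewrite exchange_big; apply: ler_sum => i _ /=.
by rewrite -mulr_sumr ler_piMr // sum_nat_eq_le1.
Qed.

Lemma sum_form_ge0 (D : {set I}) i : 0 <= sum_form R D i.
Proof. by rewrite ffunE ler0n. Qed.

(** The number d of elements of [X n] in the cut is an integer. Either d <= 1 and [X n] has no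
    slack, or d >= 2 and the loss, at most d, is at most 2(d - 1). *)
Lemma deletable_cut (D : {set I}) :
  (forall j, (j < n)%N -> 1 <= \sum_(i in X j) sum_form R D i) ->
  deletable n X (sum_form R D) 1.
Proof.
move=> cut; split=> //.
have dE : \sum_(i in X n) sum_form R D i = (\sum_(i in X n) (i \in D))%N%:R.
  by rewrite natr_sum; apply: eq_bigr => i _; rewrite ffunE.
rewrite dE; set d := (\sum_(i in X n) _)%N in dE *.
have [d1|d2] := leqP d 1; first by left; rewrite lern1.
right=> C; rewrite -dE; apply: le_trans (deletion_loss C (sum_form_ge0 D)) _.
by rewrite dE; have : 2%:R <= d%:R :> R; [rewrite ler_nat | lra].
Qed.

Lemma deletable_eq (a : {ffun I -> R}) (b : R) :
  (forall j, (j <= n)%N -> \sum_(i in X j) a i = b) ->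
  forall a' b', (a', b') \in lin_eq a b -> deletable n X a' b'.
Proof.
move=> eqb a' b'; rewrite !inE => /orP[] /eqP[-> ->].
  by split=> [j /ltnW/eqb ->|] //; left; rewrite eqb.
have sumN j : (j <= n)%N -> \sum_(i in X j) (- a) i = - b.
  by move=> /eqb <-; rewrite -sumrN; apply: eq_bigr => i _; rewrite opp_ffunE.
by split=> [j /ltnW/sumN ->|] //; left; rewrite sumN.
Qed.

Lemma sum_form1 (A : {set I}) i :
  \sum_(k in A) sum_form R [set i] k = (i \in A)%:R.
Proof.
rewrite big_mkcond (bigD1 i) //= big1 => [|k ki].
  by rewrite addr0 ffunE inE eqxx; case: (i \in A).
by rewrite ffunE inE (negbTE ki) if_same.
Qed.

(** For the upper bounds, an element outside [X n] leaves slack 1 there, and only the set of index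
    [own i] can use it up. *)
Lemma deletable_box a b : (a, b) \in box R I -> deletable n X a b.
Proof.
rewrite mem_cat => /orP[] /mapP[i _ [-> ->]].
  split=> [j _|]; first by rewrite sum_form1 ler0n.
  right=> C; apply: le_trans (deletion_loss C (sum_form_ge0 _)) _.
  by rewrite sum_form1; case: (i \in X n); rewrite /=; lra.
have sumN (A : {set I}) : \sum_(k in A) (- sum_form R [set i]) k = - (i \in A)%:R.
  by rewrite -sum_form1 -sumrN; apply: eq_bigr => k _; rewrite opp_ffunE.
split=> [j _|]; first by rewrite sumN lerN2 lern1 leq_b1.
rewrite sumN; have [_|iX] := boolP (i \in X n); first by left.
right=> C; apply: (@le_trans _ _ (\sum_(j in C) (own i == j)%:R)); last first.
  by apply: le_trans (sum_nat_eq_le1 _ _ _) _; rewrite /=; lra.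
apply: ler_sum => j _; rewrite sumN.
have [_|/ownP ->] := eqVneq (own i) j; last exact: ltn_ord.
  by case: (i \in X j); rewrite /=; lra.
by rewrite (negbTE iX) /=; lra.
Qed.

End DeletionFamily.

(** * Attained minima *)

Lemma sum_subsets0 (R : pzRingType) (I : finType) (F : {set I} -> R) :
  \sum_(T : {set I} | T \subset finset.set0) (-1) ^+ #|T| * F T
  = F finset.set0.
Proof.
rewrite (big_pred1 finset.set0) ?cards0 ?mul1r // => T.
exact: finset.subset0.
Qed.

(** This is the case where [S] and [Q] are empty. *)
Lemma sherali_adams_sub (R : realType) (I : finType) (t : nat)
    (sys : seq ({ffun I -> R} * R)) (y : {set I} -> R) a b :
  sherali_adams t sys y -> (a, b) \in sys -> b <= \sum_i a i * y [set i].
Proof.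
move=> [y0 ySA] /ySA/(_ finset.set0 finset.set0).
rewrite !cards0 => /(_ _ isT).
rewrite (sum_subsets0 (fun T => y (finset.set0 :|: T))) finset.setU0 y0 mulr1.
under eq_bigr do
  rewrite (sum_subsets0 (fun T => y (finset.set0 :|: T :|: [set _])))
    finset.setU0 finset.set0U.
by apply; rewrite finset.disjoints_subset finset.sub0set.
Qed.

(** Supplies the boundedness for the compactness argument. The box inequalities of [i], conditioned
    on the rest of [S], give [0 <= y S <= y (S :\ i)], and induction on the size of [S] does the
    rest. *)
Lemma sherali_adams_box (R : realType) (I : finType) (t : nat)
    (sys : seq ({ffun I -> R} * R)) (y : {set I} -> R) (S : {set I}) :
  {subset box R I <= sys} -> sherali_adams t sys y -> (#|S| <= t.+1)%N ->
  0 <= y S <= 1.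
Proof.
move=> sub [y0 ySA].
have y1 (S' : {set I}) i : (#|S'| <= t)%N -> 0 <= y (S' :|: [set i]) <= y S'.
  move=> cS'.
  have form_sum (F : I -> R) : \sum_k sum_form R [set i] k * F k = F i.
    rewrite (bigD1 i) //= big1 ?addr0 ?ffunE ?inE ?eqxx ?mul1r // => k ki.
    by rewrite ffunE inE (negbTE ki) mul0r.
  have nform_sum (F : I -> R) : \sum_k (- sum_form R [set i]) k * F k = - F i.
    by rewrite -form_sum -sumrN; apply: eq_bigr => k _; rewrite opp_ffunE mulNr.
  have dS0 : [disjoint S' & (finset.set0 : {set I})].
    by rewrite disjoint_sym finset.disjoints_subset finset.sub0set.
  have c0 : (#|S'| + #|(finset.set0 : {set I})| <= t)%N by rewrite cards0 addn0.
  apply/andP; split.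
    have ins : (sum_form R [set i], 0) \in sys.
      apply: sub; rewrite mem_cat; apply/orP; left.
      by apply/mapP; exists i; rewrite ?mem_enum.
    have := ySA _ _ ins _ _ dS0 c0.
    rewrite form_sum mul0r (sum_subsets0 (fun T => y (S' :|: T :|: [set i]))).
    by rewrite finset.setU0.
  have ins : (- sum_form R [set i], -1) \in sys.
    apply: sub; rewrite mem_cat; apply/orP; right.
    by apply/mapP; exists i; rewrite ?mem_enum.
  have := ySA _ _ ins _ _ dS0 c0.
  rewrite nform_sum (sum_subsets0 (fun T => y (S' :|: T :|: [set i]))).
  by rewrite (sum_subsets0 (fun T => y (S' :|: T))) !finset.setU0 mulN1r lerN2.
have [n] := ubnP #|S|; elim: n S => // n IH S Sn cS.
have [->|[i iS]] := set_0Vmem S; first by rewrite y0 lexx ler01.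
have cSi : #|S :\ i|.+1 = #|S| by rewrite [in RHS](cardsD1 i) iS.
have SE : S = (S :\ i) :|: [set i] by rewrite finset.setUC finset.setD1K.
have cSt : (#|S :\ i| <= t)%N by rewrite -ltnS cSi.
have /andP[h0 h1] := y1 _ i cSt; rewrite -SE in h0 h1.
rewrite h0 /=; apply: (le_trans h1).
have /andP[] // : 0 <= y (S :\ i) <= 1.
by apply: IH; [rewrite cSi -ltnS | exact: leqW].
Qed.

Section Attainment.
Import topology normedtype derive numFieldNormedType.Exports.
Local Open Scope classical_set_scope.

(** Feasible points are identified with vectors in a cube, where the constraints are closed
    conditions; a continuous objective attains its minimum on the resulting compact set. *)
Lemma sherali_adams_min (R : realType) (I : finType) (t : nat)
    (sys : seq ({ffun I -> R} * R)) (c : I -> R) (y0 : {set I} -> R) :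
  {subset box R I <= sys} -> sherali_adams t sys y0 ->
  exists m, is_min [set x | exists2 y, sherali_adams t sys y &
                                       x = \sum_i c i * y [set i]%SET] m.
Proof.
move=> sub y0SA.
pose n := #|{set I}|.
pose Y (v : 'rV[R]_n) (S : {set I}) : R := v ord0 (enum_rank S).
(* Coordinates at sets of more than t + 1 elements are unconstrained, hence possibly unbounded;
   setting them to 0 changes neither feasibility nor cost. *)
pose clip (y : {set I} -> R) : 'rV[R]_n :=
  \row_i (if (#|(enum_val i : {set I})| <= t.+1)%N then y (enum_val i) else 0).
have YE y (S : {set I}) : (#|S| <= t.+1)%N -> Y (clip y) S = y S.
  by move=> cS; rewrite /Y mxE enum_rankK cS.
have card1 (S Q T : {set I}) i : (#|S| + #|Q| <= t)%N -> T \subset Q ->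
    (#|S :|: T :|: [set i]%SET| <= t.+1)%N.
  move=> cSQ TQ.
  have := cardsU (S :|: T) [set i]%SET; have := cardsU S T.
  by have := subset_leq_card TQ; rewrite cards1; lia.
have card0 (S Q T : {set I}) : (#|S| + #|Q| <= t)%N -> T \subset Q ->
    (#|S :|: T| <= t.+1)%N.
  move=> cSQ TQ; have := cardsU S T.
  by have := subset_leq_card TQ; lia.
have clipSA y : sherali_adams t sys y -> sherali_adams t sys (Y (clip y)).
  move=> [ye ySA]; split=> [|a b ab S Q dSQ cSQ]; first by rewrite YE ?cards0.
  have := ySA a b ab S Q dSQ cSQ.
  congr (b * _ <= _).
    by apply: eq_bigr => T TQ; rewrite YE // (card0 _ _ _ cSQ).
  apply: eq_bigr => i _; congr (_ * _).
  by apply: eq_bigr => T TQ; rewrite YE // (card1 _ _ _ _ cSQ).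
have Ycont (S : {set I}) : continuous (fun v => Y v S) by exact: coord_continuous.
have sum_cont (J : finType) (P : pred J) (f : J -> 'rV[R]_n -> R) :
    (forall j, continuous (f j)) -> continuous (fun v => \sum_(j | P j) f j v).
  move=> fc; apply: continuous_big => //; exact: add_continuous.
have mul_cont (k : R) (f : 'rV[R]_n -> R) :
    continuous f -> continuous (fun v => k * f v).
  by move=> fc v; apply: continuousM; [exact: cst_continuous | exact: fc].
have add_cont (f g : 'rV[R]_n -> R) :
    continuous f -> continuous g -> continuous (fun v => f v + g v).
  by move=> fc gc v; exact: (@continuousD R R^o _ f g v (fc v) (gc v)).
pose K := [set v : 'rV[R]_n | forall i, `[0, 1] (v ord0 i)]
          `&` [set v | sherali_adams t sys (Y v)].
have Kcompact : compact K.
  apply: compact_closedI.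
    by apply: (@rV_compact _ _ (fun=> `[0 : R, 1])) => _; exact: segment_compact.
  pose gap (a : {ffun I -> R}) b (S Q : {set I}) v :=
    \sum_i a i * (\sum_(T : {set I} | T \subset Q)
                    (-1) ^+ #|T| * Y v (S :|: T :|: [set i]%SET))
    + - b * (\sum_(T : {set I} | T \subset Q) (-1) ^+ #|T| * Y v (S :|: T)).
  have gap_cont a b S Q : continuous (gap a b S Q).
    apply: add_cont; last first.
      by apply: (mul_cont (- b)); apply: (sum_cont) => T; exact: mul_cont.
    apply: (sum_cont) => i; apply: (mul_cont (a i)).
    by apply: (sum_cont) => T; exact: mul_cont.
  pose D := [set x : ({ffun I -> R} * R) * ({set I} * {set I}) |
    [&& x.1 \in sys, [disjoint x.2.1 & x.2.2]%B
      & (#|x.2.1| + #|x.2.2| <= t)%N]].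
  rewrite (_ : [set v | sherali_adams t sys (Y v)]
    = (fun v => Y v finset.set0) @^-1` [set 1] `&`
      \bigcap_(x in D) (gap x.1.1 x.1.2 x.2.1 x.2.2) @^-1` [set r | 0 <= r]).
    apply: closedI.
      by apply: closed_comp => //; exact: closed_eq.
    apply: closed_bigI => x _; apply: closed_comp; last exact: closed_ge.
    by move=> v _; exact: gap_cont.
  apply/seteqP; split=> v [ye ySA]; split=> //.
    move=> [[a b] [S Q]] /and3P[/= ab dSQ cSQ].
    by rewrite /gap mulNr subr_ge0; exact: ySA.
  move=> a b ab S Q dSQ cSQ.
  have := ySA ((a, b), (S, Q)); rewrite /D /= ab dSQ cSQ => /(_ isT).
  by rewrite /gap mulNr subr_ge0.
have clipK y : sherali_adams t sys y -> K (clip y).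
  move=> ySA; split; last exact: clipSA.
  move=> i /=; rewrite mxE in_itv /=; case: ifP => [cS|_].
    exact: sherali_adams_box ySA cS.
  by rewrite lexx ler01.
have costC y : \sum_i c i * Y (clip y) [set i]%SET = \sum_i c i * y [set i]%SET.
  by apply: eq_bigr => i _; rewrite YE ?cards1.
have [||v vK vmin] := @compact_EVT_min _ _
    (fun v => \sum_i c i * Y v [set i]%SET) K _ Kcompact.
- by exists (clip y0); exact: clipK.
- by apply: continuous_subspaceT; apply: (sum_cont) => i; exact: mul_cont.
exists (\sum_i c i * Y v [set i]%SET); split.
  by exists (Y v) => //; move: vK; rewrite inE => -[].
move=> _ [y ySA ->]; rewrite -(costC y); apply: (vmin (clip y)).
by rewrite inE; exact: clipK.
Qed.
End Attainment.

(** Gives the optimal Hamiltonian dipath, as all costs are natural numbers. [P] need not be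
    decidable, hence the classical [asbool]. *)
Lemma ex_min_nat (P : nat -> Prop) :
  (exists n, P n) -> exists2 n, P n & forall m, P m -> (n <= m)%N.
Proof.
move=> exP; have ex : exists n, boolp.asbool (P n).
  by case: exP => n Pn; exists n; exact/boolp.asboolP.
by case: (ex_minnP ex) => n /boolp.asboolP Pn min; exists n => // m /boolp.asboolP/min.
Qed.

Lemma uniq_path_complete (V : finType) (v : V) (s : seq V) :
  uniq (v :: s) -> path (@complete V) v s.
Proof. by rewrite uniq_pairwise => /pairwise_sorted. Qed.

Lemma ex_hamiltonian_dipath (V : finType) (p q : V) : p != q ->
  exists s, hamiltonian_dipath (@complete V) p q s.
Proof.
move=> pq; pose s := rcons [seq v <- enum V | (v != p) && (v != q)] q.
have us : uniq (p :: s).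
  rewrite /= rcons_uniq mem_rcons inE (negbTE pq) !mem_filter !eqxx !andbF /=.
  by rewrite filter_uniq ?enum_uniq.
exists s; rewrite /hamiltonian_dipath /dipath us uniq_path_complete //.
rewrite last_rcons eqxx /=; apply/forallP => v.
rewrite inE mem_rcons inE mem_filter mem_enum.
by case: (v == p); case: (v == q).
Qed.

(** * Tours and costs in terms of integers *)

(* Vertices are encoded as f_i = 2i and b_i = 2i+1, so that v./2 is the position
   of v; thus p = 0, q = 2N and u = 2N+1.  [next N j] is the successor in X_j
   together with the arc (q, p), which makes it a permutation; j = N gives X_N. *)
Definition next (N j v : nat) : nat :=
  if v == N.*2 then 0%N
  else if v == j.*2 then v.+1
  else if v == j.*2.+3 then v.-1
  else if v == 1%N then N.*2.+1
  else if odd v then v.-2 else v.+2.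

(* The number of steps of [next N j] from p to v, for j < N. *)
Definition rank (N j v : nat) : nat :=
  if (v./2 <= j)%N then if odd v then (j.*2.+1 - v./2)%N else v./2
  else if odd v then (j.*2.+2 + N - v./2)%N else (N.+1 + v./2)%N.

(* The only j for which the successor of v in X_j can differ from that in X_N;
   the value N stands for none. *)
Definition owner (N v : nat) : nat :=
  if odd v then if v == 1%N then N else v./2.-1 else v./2.

Ltac nat_cases := repeat (case: ifP; move=> ?); lia.

Lemma next_lt N j v : (j <= N)%N -> (v < N.*2.+2)%N -> (next N j v < N.*2.+2)%N.
Proof. rewrite /next; nat_cases. Qed.

Lemma next_inj N j v w : (j <= N)%N -> (v < N.*2.+2)%N -> (w < N.*2.+2)%N ->
  next N j v = next N j w -> v = w.
Proof. rewrite /next; nat_cases. Qed.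

Lemma next_neq N j v : (0 < N)%N -> next N j v != v.
Proof. rewrite /next; nat_cases. Qed.

Lemma next_owner N j v : owner N v != j -> (j < N)%N -> (v < N.*2.+2)%N ->
  next N j v = next N N v.
Proof. rewrite /next /owner; nat_cases. Qed.

(** Certifies that for [j < N] the arcs form a single dipath. No such rank exists for [j = N], where
    the vertices b_i form a dicycle. *)
Lemma rank_next N j v : (j < N)%N -> (v < N.*2.+2)%N -> v != N.*2 ->
  rank N j (next N j v) = (rank N j v).+1.
Proof. by rewrite /next; do ![case: ifP => ?]; rewrite /rank; nat_cases. Qed.

(* |i - j| for positions i and j, and |i - N| + 2i = N + i from i to u. *)
Definition dist (N v w : nat) : nat :=
  ((v./2 - w./2) + (w./2 - v./2) + (w == N.*2.+1) * v./2.*2)%N.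

Lemma dist_triangle N u v w : (u < N.*2.+2)%N -> (v < N.*2.+2)%N ->
  (dist N u w <= dist N u v + dist N v w)%N.
Proof.
by rewrite /dist => ? ?; do 2![case: eqP => ?]; rewrite ?mul1n ?mul0n; lia.
Qed.

Lemma dist_pos N v w :
  (v./2 <= w./2 + dist N v w)%N /\ (w./2 <= v./2 + dist N v w)%N.
Proof. by rewrite /dist; case: eqP => ?; rewrite ?mul1n ?mul0n; lia. Qed.

(** Each step costs at least the change of position, so a walk through [x] pays for the way to [x]
    and for the way on from there. The two bounds treat [x] as a turning point on the right and on
    the left. *)
Lemma walk_pass (N v x : nat) (s : seq nat) : x \in v :: s ->
  (x./2.*2 <= v./2 + (last v s)./2 + sumn (pairmap (dist N) v s)
   /\ v./2 + (last v s)./2 <= x./2.*2 + sumn (pairmap (dist N) v s))%N.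
Proof.
elim: s v x => [|w s IH] v x; rewrite in_cons => /orP[/eqP->|] //=; try by lia.
  have [|h1 h2] := IH w w; first by rewrite mem_head.
  by have := dist_pos N v w; lia.
by move=> /IH[h1 h2] /=; have := dist_pos N v w; lia.
Qed.

Lemma exists_step (P : pred nat) n : P 0%N -> ~~ P n ->
  exists2 i, (i < n)%N & P i && ~~ P i.+1.
Proof.
elim: n => [|n IH] P0 Pn; first by rewrite P0 in Pn.
have [Pn'|nPn'] := boolP (P n); first by exists n; rewrite ?Pn'.
by have [i iN Pi] := IH P0 nPn'; exists i => //; exact: leqW.
Qed.

(** Cut the dipath at u. As q comes after u, some f_i lies before u while f_{i+1} lies after it. If
    l is the last position before u, then visiting f_i and moving to l costs at least 2i - l,
    entering u at least N + l, and going from position N to i + 1 and back at least 2N - 2(i + 1).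
    These add up to 3N - 2. *)
Lemma hamiltonian_cost_ge (N : nat) (s : seq nat) :
  uniq (0%N :: s) -> {subset iota 0 N.*2.+2 <= 0%N :: s} -> last 0%N s = N.*2 ->
  (3 * N <= sumn (pairmap (dist N) 0%N s) + 2)%N.
Proof.
move=> us sub lq.
have us' : N.*2.+1 \in s.
  by have := sub N.*2.+1; rewrite mem_iota inE /= => /(_ (ltnSn _)).
case/splitPr: us' us sub lq => s1 s2 us sub lq.
have l2 : last N.*2.+1 s2 = N.*2 by move: lq; rewrite last_cat.
have qs2 : N.*2 \in N.*2.+1 :: s2.
  by rewrite -{1}l2; exact: mem_last.
have [i iN /andP[iA iB]] : exists2 i, (i < N)%N
    & (i.*2 \in 0%N :: s1) && (i.+1.*2 \notin 0%N :: s1).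
  apply: (exists_step (P := fun i => i.*2 \in 0%N :: s1)); first exact: mem_head.
  apply/negP => qs1; move: us; rewrite -cat_cons cat_uniq => /and3P[_ /hasPn + _].
  by move/(_ _ qs2); rewrite qs1.
have iC : i.+1.*2 \in N.*2.+1 :: s2.
  have : i.+1.*2 \in (0%N :: s1) ++ N.*2.+1 :: s2.
    by apply: sub; rewrite mem_iota /=; lia.
  by rewrite mem_cat (negbTE iB).
have [h1 _] := walk_pass N iA; have [_ h2] := walk_pass N iC.
rewrite l2 in h2; rewrite pairmap_cat sumn_cat /=.
have into_u : (N + (last 0%N s1)./2 <= dist N (last 0%N s1) N.*2.+1)%N.
  by rewrite /dist eqxx mul1n; lia.
lia.
Qed.

(** All arcs have unit cost except the arc from b_0 to u, of cost N. *)
Lemma dist_next_none N v : (0 < N)%N -> (v < N.*2.+2)%N -> v != N.*2 ->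
  dist N v (next N N v) = (1 + N.-1 * (v == 1))%N.
Proof.
rewrite /next => ? ? ?; do ![case: ifP => ?]; rewrite /dist; do ![case: eqP => ?];
 rewrite ?muln1 ?muln0 ?mul1n ?mul0n; lia.
Qed.

(** The unit arcs out of f_j and b_{j+1} are replaced by arcs of cost 0. The additive form avoids
    truncated subtraction. *)
Lemma dist_next N j v : (j < N)%N -> (v < N.*2.+2)%N -> v != N.*2 ->
  (dist N v (next N j v) + (v == j.*2) + (v == j.*2.+3))%N = dist N v (next N N v).
Proof.
rewrite /next => ? ? ?; do ![case: ifP => ?]; rewrite /dist; do ![case: eqP => ?];
 rewrite ?muln1 ?muln0 ?mul1n ?mul0n; lia.
Qed.

(** * The digraph and its linear program *)

Section Instance.
Variables (R : realType) (N : nat).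
Hypothesis N_gt0 : (0 < N)%N.

Local Notation V := 'I_N.*2.+2.
Local Notation edge := {e : V * V | complete e.1 e.2}.
Local Notation p := (ord0 : V).
Local Notation q := (inord N.*2 : V).
Local Notation u := (ord_max : V).

Definition succ (j : nat) (v : V) : V := inord (next N j v).

Definition tour (j : nat) : {set edge} :=
  [set e | ((val e).1 != q) && (succ j (val e).1 == (val e).2)].

Lemma qE : q = N.*2 :> nat.
Proof. by rewrite inordK. Qed.

Lemma neq_q (v : V) : (v != q) = (v != N.*2 :> nat).
Proof. by rewrite -val_eqE /= qE. Qed.

Lemma succE j v : (j <= N)%N -> succ j v = next N j v :> nat.
Proof. by move=> jN; rewrite inordK // next_lt. Qed.

Lemma succ_inj j : (j <= N)%N -> injective (succ j).
Proof.
move=> jN v w /(congr1 val) /=; rewrite !succE // => eqn.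
by apply: val_inj; apply: next_inj eqn.
Qed.

Lemma succ_neq j v : (j <= N)%N -> v != succ j v.
Proof. by move=> jN; rewrite eq_sym -val_eqE /= succE // next_neq. Qed.

Lemma succ_q j : (j <= N)%N -> succ j q = p.
Proof.
by move=> jN; apply: val_inj; rewrite /= succE // qE /next eqxx.
Qed.

Lemma succ_surj j v : (j <= N)%N -> exists w, succ j w = v.
Proof.
move=> jN; have [g _ gK] := injF_bij (succ_inj jN).
by exists (g v); exact: gK.
Qed.

Lemma tour_owner (e : edge) j : (j < N)%N -> owner N (val e).1 != j ->
  (e \in tour j) = (e \in tour N).
Proof. by move=> jN ej; rewrite !inE /succ (next_owner ej). Qed.

(** An arc of a tour is determined by its tail, which turns sums over arcs into sums over
    vertices. *)
Lemma sum_tour (F : V -> V -> R) j : (j <= N)%N ->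
  \sum_(e in tour j) F (val e).1 (val e).2
  = \sum_(v | v != q) F v (succ j v).
Proof.
move=> jN.
transitivity (\sum_(x : V * V | complete x.1 x.2 &&
                ((x.1 != q) && (succ j x.1 == x.2))) F x.1 x.2).
  rewrite (big_sub_cond (fun x : V * V => complete x.1 x.2)
    (fun x => (x.1 != q) && (succ j x.1 == x.2)) (fun x => F x.1 x.2)).
  by apply: eq_bigl => e; rewrite inE.
transitivity (\sum_(v | v != q) \sum_(w | succ j v == w) F v w); last first.
  by apply: eq_bigr => v _; rewrite (big_pred1 (succ j v)) // => w; rewrite eq_sym.
rewrite pair_big_dep /=; apply: eq_bigl => -[v w] /=.
have [<-|] := eqVneq (succ j v) w; last by rewrite !andbF.
by rewrite /complete succ_neq.
Qed.

Lemma sum_tour_in (U : {set V}) j : (j <= N)%N ->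
  \sum_(e in tour j) sum_form R (delta_in (@complete V) U) e
  = \sum_(v | v != q) ((v \notin U) && (succ j v \in U))%:R.
Proof.
move=> jN; rewrite -(sum_tour (fun v w => ((v \notin U) && (w \in U))%:R)) //.
by apply: eq_bigr => e _; rewrite ffunE inE.
Qed.

Lemma sum_tour_out (U : {set V}) j : (j <= N)%N ->
  \sum_(e in tour j) sum_form R (delta_out (@complete V) U) e
  = \sum_(v | v != q) ((v \in U) && (succ j v \notin U))%:R.
Proof.
move=> jN; rewrite -(sum_tour (fun v w => ((v \in U) && (w \notin U))%:R)) //.
by apply: eq_bigr => e _; rewrite ffunE inE.
Qed.

Lemma sum_bool_ge1 (P B : pred V) v : P v -> B v ->
  1 <= \sum_(w | P w) (B w)%:R :> R.
Proof.
move=> Pv Bv; rewrite (bigD1 v) //= Bv lerDl.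
by apply: sumr_ge0 => w _; rewrite ler0n.
Qed.

(** The predecessor of the vertex of least rank in [U] has smaller rank, so it lies outside [U]. *)
Lemma tour_in_ge1 (U : {set V}) j : (j < N)%N ->
  U != finset.set0 -> U \subset [set~ p] ->
  1 <= \sum_(e in tour j) sum_form R (delta_in (@complete V) U) e.
Proof.
move=> jN /set0Pn[w wU] Up; rewrite sum_tour_in ?(ltnW jN) //.
have [v vU vmin] := arg_minnP (fun v : V => rank N j v) wU.
have [x xv] := succ_surj v (ltnW jN).
(* The arc from q to p belongs to the permutation but not to the tour; it is avoided because p is
   not in [U]. *)
have xq : x != q.
  apply/eqP => xq; move: xv; rewrite xq succ_q ?(ltnW jN) // => pv.
  by move/fintype.subsetP: Up => /(_ _ vU); rewrite !inE -pv eqxx.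
apply: (sum_bool_ge1 (v := x)) => //; rewrite xv; apply/andP; split=> //.
apply/negP => /vmin; rewrite -xv succE ?(ltnW jN) //.
by rewrite rank_next ?ltnn // -neq_q.
Qed.

(** Dually, the successor of the vertex of greatest rank in [U] lies outside [U]. *)
Lemma tour_out_ge1 (U : {set V}) j : (j < N)%N ->
  U != finset.set0 -> U \subset [set~ q] ->
  1 <= \sum_(e in tour j) sum_form R (delta_out (@complete V) U) e.
Proof.
move=> jN /set0Pn[w wU] Uq; rewrite sum_tour_out ?(ltnW jN) //.
have [v vU vmax] := arg_maxnP (fun v : V => rank N j v) wU.
have vq : v != q.
  by move/fintype.subsetP: Uq => /(_ _ vU); rewrite !inE.
apply: (sum_bool_ge1 (v := v)) => //; apply/andP; split=> //.
apply/negP => /vmax; rewrite succE ?(ltnW jN) //.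
by rewrite rank_next /= ?ltnn // -neq_q.
Qed.

Lemma tour_in_eq1 v j : (j <= N)%N -> v != p ->
  \sum_(e in tour j) sum_form R (delta_in (@complete V) [set v]) e = 1.
Proof.
move=> jN vp; rewrite sum_tour_in //; have [w wv] := succ_surj v jN.
have wq : w != q by apply: contra_neq vp => wq; rewrite -wv wq succ_q.
rewrite (bigD1 w) //= big1 => [|x /andP[_ xw]].
  by rewrite !inE wv eqxx -wv succ_neq ?addr0.
rewrite !inE; case: eqP => // xv; case: eqP => // sxv.
by move: xw; rewrite (succ_inj jN (etrans sxv (esym wv))) eqxx.
Qed.

Lemma tour_in_p j : (j <= N)%N ->
  \sum_(e in tour j) sum_form R (delta_in (@complete V) [set p]) e = 0.
Proof.
move=> jN; rewrite sum_tour_in // big1 // => v vq.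
rewrite !inE -(succ_q jN) (inj_eq (succ_inj jN)) (negbTE vq) andbF //.
Qed.

Lemma tour_out_eq1 v j : (j <= N)%N -> v != q ->
  \sum_(e in tour j) sum_form R (delta_out (@complete V) [set v]) e = 1.
Proof.
move=> jN vq; rewrite sum_tour_out // (bigD1 v) //= big1 => [|x /andP[_ xv]].
  by rewrite !inE eqxx eq_sym succ_neq ?addr0.
by rewrite !inE (negbTE xv).
Qed.

Lemma tour_out_q j : (j <= N)%N ->
  \sum_(e in tour j) sum_form R (delta_out (@complete V) [set q]) e = 0.
Proof.
move=> jN; rewrite sum_tour_out // big1 // => v vq.
by rewrite !inE (negbTE vq).
Qed.

Definition lp_solution (t : nat) : {set edge} -> R :=
  moments N.+1 (deletion_weight R t N) tour.

Lemma lp_solution_feasible t : (t.+2 <= N)%N ->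
  sherali_adams t (path_atsp_lp R (@complete V) p q) (lp_solution t).
Proof.
move=> tN.
apply: (@moments_sherali_adams _ _ _ _ _ _
          (fun e : edge => owner N (val e).1)) => //.
  by move=> e j; exact: tour_owner.
have own := tour_owner.
move=> a b.
rewrite !mem_cat => /orP[|/orP[|/orP[|/orP[|/orP[|/orP[|]]]]]].
- case/mapP => U; rewrite mem_filter => /andP[/andP[U0 Up] _] [-> ->].
  by apply: (deletable_cut own) => j jN; exact: tour_in_ge1.
- case/mapP => U; rewrite mem_filter => /andP[/andP[U0 Up] _] [-> ->].
  by apply: (deletable_cut own) => j jN; exact: tour_out_ge1.
- case/flatten_mapP => v; rewrite mem_filter => /andP[vp _].
  by apply: deletable_eq => j jN; exact: tour_in_eq1.
- case/flatten_mapP => v; rewrite mem_filter => /andP[vp _].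
  by apply: deletable_eq => j jN; exact: tour_out_eq1.
- by apply: deletable_eq => j jN; exact: tour_in_p.
- by apply: deletable_eq => j jN; exact: tour_out_q.
- by rewrite -mem_cat => abox; exact: (deletable_box own).
Qed.

(** * Costs of the tours and of the fractional solution *)

Definition cost (v w : V) : R := (dist N v w)%:R.

Lemma sum_indicator (k : nat) : (k < N.*2.+2)%N -> k != N.*2 ->
  \sum_(v : V | v != q) (v == k :> nat)%:R = 1 :> R.
Proof.
move=> kN kq; rewrite (bigD1 (inord k)) /=; last by rewrite neq_q inordK.
rewrite inordK // eqxx big1 ?addr0 // => v /andP[_].
by rewrite -val_eqE /= inordK // => /negbTE ->.
Qed.

Lemma sum_tour_cost j : (j <= N)%N ->
  \sum_(e in tour j) cost (val e).1 (val e).2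
  = \sum_(v : V | v != q) (dist N v (next N j v))%:R.
Proof.
move=> jN; rewrite sum_tour //; apply: eq_bigr => v _.
by rewrite /cost succE.
Qed.

(** Each of the 2N + 1 tails contributes 1, and b_0 contributes N - 1 more. *)
Lemma tour_cost_none : \sum_(e in tour N) cost (val e).1 (val e).2 = (3 * N)%:R.
Proof.
rewrite sum_tour_cost //.
have cardq : #|[pred v : V | v != q]| = N.*2.+1.
  by have := cardC1 q; rewrite card_ord.
transitivity (\sum_(v : V | v != q) (1 + N.-1%:R * (v == 1 :> nat)%:R) : R).
  apply: eq_bigr => v vq; rewrite dist_next_none -?neq_q //.
  by rewrite natrD natrM.
rewrite big_split /= -mulr_sumr sum_indicator //; last by lia.
rewrite sumr_const cardq mulr1 -natrD; congr _%:R; lia.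
Qed.

Lemma tour_cost_deleted j : (j < N)%N ->
  \sum_(e in tour j) cost (val e).1 (val e).2 = (3 * N)%:R - 2.
Proof.
move=> jN; rewrite -tour_cost_none !sum_tour_cost ?(ltnW jN) //.
apply: (canRL (addrK 2)).
transitivity (\sum_(v : V | v != q) (dist N v (next N j v))%:R
  + \sum_(v : V | v != q) (v == j.*2 :> nat)%:R
  + \sum_(v : V | v != q) (v == j.*2.+3 :> nat)%:R : R).
  by rewrite !sum_indicator; [lra|lia..].
rewrite -!big_split /=; apply: eq_bigr => v vq.
by rewrite -(dist_next jN) -?neq_q // !natrD.
Qed.

Lemma lp_solution_cost t : (t.+2 <= N)%N ->
  sa_cost cost (lp_solution t) = N%:R * (3 * t%:R + 4) / (t%:R + 2).
Proof.
move=> tN.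
transitivity (\sum_(j < N.+1) deletion_weight R t N j
                * \sum_(e in tour j) cost (val e).1 (val e).2).
  rewrite /sa_cost /lp_solution /moments.
  under eq_bigr do rewrite mulr_sumr.
  rewrite exchange_big; apply: eq_bigr => j _ /=.
  rewrite mulr_sumr [RHS]big_mkcond; apply: eq_bigr => e _ /=.
  by rewrite finset.sub1set; case: ifP => _; rewrite /cost /=; ring.
rewrite big_ord_recr /= tour_cost_none /deletion_weight eqxx.
under eq_bigr => j _ do rewrite ltn_eqF // tour_cost_deleted //.
rewrite sumr_const card_ord -mulr_natl natrM -addn2 natrD.
field; apply: lt0r_neq0; have : 0 <= t%:R :> R by rewrite ler0n.
lra.
Qed.

(** * Metric completion and integrality ratio *)

Lemma dipath_costE v s :
  dipath_cost cost v s = (sumn (pairmap (dist N) v (map val s)))%:R.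
Proof.
rewrite /dipath_cost; elim: s v => [|w s IH] v /=; first by rewrite big_nil.
by rewrite big_cons IH natrD.
Qed.

Lemma walk_triangle (v w : V) (s : seq V) :
  (dist N v (last w s) <= sumn (pairmap (dist N) v (map val (w :: s))))%N.
Proof.
elim: s v w => [|x s IH] v w /=; first by rewrite addn0.
have := IH w x; have := dist_triangle (last x s) (ltn_ord v) (ltn_ord w).
rewrite /=; lia.
Qed.

(** The costs satisfy the triangle inequality, so the complete digraph is its own metric completion
    and serves as both G and H. *)
Lemma cost_metric_completion : is_metric_completion (@complete V) cost cost.
Proof.
move=> v w vw; split.
  exists [:: w]; first by rewrite /dipath /= vw inE (vw : v != w) eqxx.
  by rewrite dipath_costE /= addn0.
move=> _ [[|x s] /and3P[_ _ /eqP /= lw] ->].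
  by rewrite /complete lw eqxx in vw.
by rewrite dipath_costE /cost ler_nat -lw walk_triangle.
Qed.

Lemma cost_into_u (v : V) : (N <= dist N v u)%N.
Proof. by have := ltn_ord v; rewrite /dist /= eqxx mul1n; lia. Qed.

(** At least one unit enters u, over arcs of cost at least N each. This makes the denominator of the
    ratio positive. *)
Lemma sa_cost_gt0 t y :
  sherali_adams t (path_atsp_lp R (@complete V) p q) y -> 0 < sa_cost cost y.
Proof.
move=> ySA.
have boxS : {subset box R edge <= path_atsp_lp R (@complete V) p q}.
  by move=> ab abx; rewrite !mem_cat -mem_cat abx !orbT.
have y0 e : 0 <= y [set e].
  have c1 : (#|[set e]| <= t.+1)%N by rewrite cards1.
  by have /andP[] := sherali_adams_box boxS ySA c1.
have ucut : (sum_form R (delta_in (@complete V) [set u]), 1)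
              \in path_atsp_lp R (@complete V) p q.
  rewrite mem_cat; apply/orP; left; apply/mapP; exists [set u] => //.
  rewrite mem_filter mem_enum andbT; apply/andP; split.
    by apply/set0Pn; exists u; rewrite inE.
  by rewrite finset.sub1set !inE -val_eqE.
have := sherali_adams_sub ySA ucut => cut1.
apply: (@lt_le_trans _ _ N%:R); first by rewrite ltr0n.
rewrite -[N%:R]mulr1; apply: (le_trans (ler_wpM2l (ler0n _ N) cut1)).
rewrite mulr_sumr; apply: ler_sum => e _; rewrite mulrA ler_wpM2r // ffunE !inE.
case: andP => [[_ /eqP ->]|_]; last by rewrite mulr0 ler0n.
by rewrite mulr1 ler_nat cost_into_u.
Qed.

Lemma hamiltonian_dipath_cost_ge s : hamiltonian_dipath (@complete V) p q s ->
  (3 * N)%:R - 2 <= dipath_cost cost p s.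
Proof.
move=> /andP[/and3P[_ us /eqP ls] /forallP all_s].
rewrite dipath_costE lerBlDr -natrD ler_nat; apply: hamiltonian_cost_ge.
- by rewrite -[0%N]/(val p) -map_cons map_inj_uniq //; exact: val_inj.
- move=> k; rewrite mem_iota /= => kN.
  rewrite -[0%N]/(val p) -map_cons -(inordK kN).
  exact: map_f.
- by rewrite -[0%N]/(val p) last_map ls /= inordK.
Qed.

Lemma integrality_ratio_ge t : (t.+2 <= N)%N ->
  exists2 r, is_integrality_ratio cost p q t r
           & ((3 * N)%:R - 2) / (N%:R * (3 * t%:R + 4) / (t%:R + 2)) <= r.
Proof.
move=> tN.
have boxS : {subset box R edge <= path_atsp_lp R (@complete V) p q}.
  by move=> ab abx; rewrite !mem_cat -mem_cat abx !orbT.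
have pq : p != q by rewrite neq_q /=; lia.
have [lp lpmin] := sherali_adams_min (fun e : edge => cost (val e).1 (val e).2)
  boxS (lp_solution_feasible tN).
have lp_gt0 : 0 < lp by case: lpmin => -[y ySA ->] _; exact: sa_cost_gt0 ySA.
have lp_le : lp <= N%:R * (3 * t%:R + 4) / (t%:R + 2).
  case: lpmin => _; apply; exists (lp_solution t).
    exact: lp_solution_feasible.
  by rewrite -lp_solution_cost.
have [s0 s0H] := ex_hamiltonian_dipath pq.
have [|n [s sH sn] nmin] := @ex_min_nat (fun n => exists2 s,
    hamiltonian_dipath (@complete V) p q s & dipath_cost cost p s = n%:R).
  by exists (sumn (pairmap (dist N) p (map val s0))), s0; rewrite ?dipath_costE.
have opt_ge : (3 * N)%:R - 2 <= n%:R :> R.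
  by rewrite -sn hamiltonian_dipath_cost_ge.
exists (n%:R / lp).
  exists n%:R, lp; split=> //; split; first by exists s.
  move=> _ [s' s'H ->]; rewrite dipath_costE ler_nat; apply: nmin.
  by exists s' => //; rewrite dipath_costE.
have N1 : (1 : R) <= N%:R by rewrite ler1n.
apply: (@le_trans _ _ (((3 * N)%:R - 2) / lp)).
  apply: ler_wpM2l; first by rewrite natrM; lra.
  by rewrite lef_pV2 // posrE //; exact: lt_le_trans lp_le.
by rewrite ler_pM2r // invr_gt0.
Qed.

End Instance.

(** * Choice of the size of the instance *)

(** The order t / eps is read with max(t, 1) in place of t, because for t = 0 it would force the
    number of vertices to be 0. *)
Theorem theorem7 (R : realType) :
  exists (nu : nat -> R -> nat) (eps0 k K : R),
    [/\ 0 < eps0, 0 < k & 0 < K] /\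
    forall (t : nat) (eps : R), 0 < eps -> eps < eps0 ->
      (k * ((maxn t 1)%:R / eps) <= (nu t eps)%:R
         /\ (nu t eps)%:R <= K * ((maxn t 1)%:R / eps)) /\
      exists (E : rel 'I_(nu t eps)) (c : 'I_(nu t eps) -> 'I_(nu t eps) -> R)
             (p q : 'I_(nu t eps)) (c' : 'I_(nu t eps) -> 'I_(nu t eps) -> R)
             (r : R),
        [/\ nonneg_costs E c, p != q, is_metric_completion E c c',
            is_integrality_ratio c' p q t r
          & 1 + (2 - eps) / (3 * t%:R + 4) <= r].
Proof.
(* Chosen so that N eps > 2(t + 2), which the final inequality requires; with eps < 1 this also
   gives N >= t + 2. *)
pose N (t : nat) (eps : R) := (Num.truncn (2 * (t%:R + 2) / eps)).+1.
(* The constant 16 comes from (2N + 2) eps <= 4(t + 2) + 4 eps <= 4t + 12 <= 16 max(t, 1). *)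
exists (fun t eps => (N t eps).*2.+2), 1, 1, 16; split; first by split; lra.
move=> t eps eps_gt0 eps_lt1; set n := N t eps.
have t0 : 0 <= t%:R :> R by rewrite ler0n.
have x_ge0 : 0 <= 2 * (t%:R + 2) / eps by apply: divr_ge0; lra.
have /andP[n_le n_gt] := truncn_itv x_ge0; rewrite -/n in n_gt.
have n_le1 : n%:R <= 2 * (t%:R + 2) / eps + 1 :> R.
  by rewrite /n /N -natr1 lerD2r.
have neps : 2 * (t%:R + 2) < n%:R * eps by rewrite -ltr_pdivrMr.
have tn : (t.+2 <= n)%N.
  rewrite -(ler_nat R) -addn2 natrD.
  have : n%:R * eps <= n%:R :> R by rewrite ler_piMr ?ler0n // ltW.
  lra.
have n0 : (0 < n)%N by apply: leq_trans tn.
have nuE : n.*2.+2%:R = 2 * n%:R + 2 :> R by rewrite -addn2 natrD -mul2n natrM.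
have maxE : t%:R <= (maxn t 1)%:R :> R /\ 1 <= (maxn t 1)%:R :> R.
  by rewrite ler_nat ler1n leq_maxl leq_maxr.
have maxE' : (maxn t 1)%:R <= t%:R + 1 :> R by rewrite natr1 ler_nat geq_max leqnSn.
split; first split.
- rewrite mul1r ler_pdivrMr // nuE; lra.
- rewrite nuE mulrA ler_pdivlMr //.
  have : n%:R * eps <= 2 * (t%:R + 2) + eps.
    by rewrite -ler_pdivlMr // mulrDl divff ?gt_eqF.
  lra.
have [r rr r_ge] := integrality_ratio_ge R n0 tn.
exists (@complete _), (@cost R n), ord0, (inord n.*2), (@cost R n), r; split=> //.
- by rewrite neq_q eq_sym -lt0n double_gt0.
- exact: cost_metric_completion.
apply: le_trans r_ge.
have nR : 1 <= n%:R :> R by rewrite ler1n.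
rewrite natrM.
have -> : (3%:R * n%:R - 2) / (n%:R * (3 * t%:R + 4) / (t%:R + 2))
        = (3%:R * n%:R - 2) * (t%:R + 2) / (n%:R * (3 * t%:R + 4)) :> R.
  field; lra.
have -> : 1 + (2 - eps) / (3 * t%:R + 4) = (3 * t%:R + 6 - eps) / (3 * t%:R + 4).
  field; lra.
rewrite ler_pdivrMr; last by lra.
rewrite mulrAC ler_pdivlMr; last by apply: mulr_gt0; lra.
(* This product is exactly the difference of the two sides after clearing denominators. *)
have : 0 <= (3 * t%:R + 4) * (n%:R * eps - 2 * (t%:R + 2)).
  by apply: mulr_ge0; lra.
lra.
Qed.
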